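(* Let $\phi:\mathbb{R}^d\to\mathbb{R}$ be bounded below, twice continuously differentiable, with $M$-Lipschitz continuous gradient ($M>0$), and $m$-strongly convex with $0<m\le M$. Let $f:\mathbb{R}^d\to\mathbb{R}$, $g:\mathbb{R}^d\to\mathbb{R}^d$ and constants $\epsilon_f,\epsilon_g\ge 0$ satisfy $|f(x)-\phi(x)|\le\epsilon_f$ and $\|g(x)-\nabla\phi(x)\|\le\epsilon_g$ for all $x\in\mathbb{R}^d$. Let $\{x_k\}$ be generated by the BFGS method with errors (described in the context) with constants $0<c_1<c_2<1$ and lengthening parameter $l>0$ satisfying $l>2\epsilon_g/m$. Fix $q\in(0,1)$, and let $\beta_1$, $A$, $B$ be the constants defined in the context. Let $$\mathcal{N}_1=\left\{x\in\mathbb{R}^d \;:\; \|\nabla\phi(x)\|\le\max\left\{A\frac{\sqrt{M\epsilon_f}}{\beta_1},\ B\frac{\epsilon_g}{\beta_1}\right\}\right\},$$ and let $K=\min\{k\in\mathbb{N}: x_k\in\mathcal{N}_1\}$ be the index of the first iterate that enters $\mathcal{N}_1$ (with $K=+\infty$ if no such iterate exists). Let $\phi^*$ be the optimal (minimum) value of $\phi$. Then there exists $\rho\in(0,1)$ such that $$\phi(x_k)-\phi^*\le\rho^k\,(\phi(x_0)-\phi^* )+2\epsilon_f\qquad\text{for all } k\le K-1.$$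
   Context: $\|\cdot\|$ is the Euclidean norm; $\mathbb{N}=\{0,1,2,\dots\}$. BFGS method with errors. Inputs: $f$, $g$, constants $0<c_1<c_2<1$, lengthening parameter $l>0$, starting point $x_0\in\mathbb{R}^d$, symmetric positive definite $H_0\in\mathbb{R}^{d\times d}$. For $k=0,1,2,\dots$: (1) $p_k=-H_kg(x_k)$. (2) Line search: if there exists $\alpha>0$ such that $f(x_k+\alpha p_k)\le f(x_k)+c_1\alpha p_k^Tg(x_k)$ and $p_k^Tg(x_k+\alpha p_k)\ge c_2p_k^Tg(x_k)$, then $\alpha_k$ is set to some such $\alpha$ (any one of them); otherwise $\alpha_k=0$. (3) If $\|\alpha_kp_k\|\ge l$, set $s_k=\alpha_kp_k$; otherwise set $s_k=l\,p_k/\|p_k\|$. In both cases $y_k=g(x_k+s_k)-g(x_k)$. (4) $H_{k+1}=(I-\rho_ks_ky_k^T)H_k(I-\rho_ky_ks_k^T)+\rho_ks_ks_k^T$ with $\rho_k=1/(s_k^Ty_k)$. (5) $x_{k+1}=x_k+\alpha_kp_k$. It is understood that $g(x_k)\ne0$ for all $k$, so that all steps are defined. Constants: $B_0=H_0^{-1}$, $\widehat m=m-2\epsilon_g/l$, $\widehat M=M+2\epsilon_g/l$, $$\beta_0=\frac{1}{1-q}\left[\mathrm{tr}(B_0)-\log\det(B_0)+\widehat M-1-\log\widehat m\right],\qquad \beta_1=e^{-\beta_0/2}\in(0,1),$$ $$A=\max\left\{\frac{16\sqrt2}{\sqrt{(c_2-c_1)(4-c_1-3c_2)}},\ \frac{8}{\sqrt{c_1(1-c_2)}}\right\},\qquad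 B=\max\left\{\frac{8}{1-c_2},\ \frac{8(1+c_1)}{c_2-c_1}+6\right\}.$$ *)

(* Defs.v *)
From HB Require Import structures.
From mathcomp Require Import all_boot all_order all_algebra.
From mathcomp Require Import all_classical all_reals all_analysis.

Set Implicit Arguments.
Unset Strict Implicit.
Unset Printing Implicit Defensive.

Import Order.TTheory GRing.Theory Num.Theory.
Import numFieldNormedType.Exports.

Local Open Scope classical_set_scope.
Local Open Scope ring_scope.

(* R^d is 'cV[R]_d.  The library norm on matrices is the sup norm: it serves
   only for topology and differentiability (where it is equivalent to the
   Euclidean norm); every quantitative norm below is the Euclidean [enorm]. *)

Definition dot (R : realType) (d : nat) (u v : 'cV[R]_d) : R :=
  (u^T *m v) ord0 ord0.

Definition enorm (R : realType) (d : nat) (v : 'cV[R]_d) : R :=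
  Num.sqrt (dot v v).

Definition basis_vec (R : realType) (d : nat) (i : 'I_d) : 'cV[R]_d :=
  delta_mx i ord0.

Definition grad (R : realType) (d : nat) (phi : 'cV[R]_d -> R)
    (x : 'cV[R]_d) : 'cV[R]_d :=
  \col_i 'D_(basis_vec R i) phi x.

Definition hessian (R : realType) (d : nat) (phi : 'cV[R]_d -> R)
    (x : 'cV[R]_d) : 'M[R]_d :=
  \matrix_(i, j) 'D_(basis_vec R j) (fun z => grad phi z i ord0) x.

Definition twice_continuously_differentiable (R : realType) (d : nat)
    (phi : 'cV[R]_d -> R) : Prop :=
  [/\ forall x, differentiable phi x,
      forall x, differentiable (grad phi) x
    & continuous (hessian phi)].

Definition lipschitz_gradient (R : realType) (d : nat) (M : R)
    (phi : 'cV[R]_d -> R) : Prop :=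
  forall x y, enorm (grad phi x - grad phi y) <= M * enorm (x - y).

Definition strongly_convex (R : realType) (d : nat) (m : R)
    (phi : 'cV[R]_d -> R) : Prop :=
  forall (x y : 'cV[R]_d) (t : R), 0 <= t <= 1 ->
    phi (t *: x + (1 - t) *: y) <=
      t * phi x + (1 - t) * phi y
      - m / 2 * (t * (1 - t)) * enorm (x - y) ^+ 2.

Definition sym_posdef (R : realType) (d : nat) (H : 'M[R]_d) : Prop :=
  H^T = H /\ forall v : 'cV[R]_d, v != 0 -> 0 < dot v (H *m v).

Definition armijo_wolfe (R : realType) (d : nat) (f : 'cV[R]_d -> R)
    (g : 'cV[R]_d -> 'cV[R]_d) (c1 c2 : R) (x p : 'cV[R]_d) (a : R) : Prop :=
  f (x + a *: p) <= f x + c1 * a * dot p (g x) /\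
  c2 * dot p (g x) <= dot p (g (x + a *: p)).

(* [a] is an admissible output of the line search. *)
Definition line_search (R : realType) (d : nat) (f : 'cV[R]_d -> R)
    (g : 'cV[R]_d -> 'cV[R]_d) (c1 c2 : R) (x p : 'cV[R]_d) (a : R) : Prop :=
  let ok b := 0 < b /\ armijo_wolfe f g c1 c2 x p b in
  ((exists b, ok b) -> ok a) /\ (~ (exists b, ok b) -> a = 0).

Definition lengthened_step (R : realType) (d : nat) (l a : R)
    (p : 'cV[R]_d) : 'cV[R]_d :=
  if l <= enorm (a *: p) then a *: p else (l / enorm p) *: p.

Definition bfgs_update (R : realType) (d : nat) (H : 'M[R]_d)
    (s y : 'cV[R]_d) : 'M[R]_d :=
  let rho := (dot s y)^-1 in
  (1%:M - rho *: (s *m y^T)) *m H *m (1%:M - rho *: (y *m s^T))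
  + rho *: (s *m s^T).

(* The algorithm is a relation, not a function: the line search may return any
   acceptable step length. *)
Record bfgs_with_errors (R : realType) (d : nat) (f : 'cV[R]_d -> R)
    (g : 'cV[R]_d -> 'cV[R]_d) (c1 c2 l : R) (x0 : 'cV[R]_d) (H0 : 'M[R]_d)
    (x p s y : nat -> 'cV[R]_d) (alpha : nat -> R) (H : nat -> 'M[R]_d)
    : Prop := {
  bfgs_x0 : x 0%N = x0;
  bfgs_H0 : H 0%N = H0;
  bfgs_p : forall k, p k = - (H k *m g (x k));
  bfgs_alpha : forall k, line_search f g c1 c2 (x k) (p k) (alpha k);
  bfgs_s : forall k, s k = lengthened_step l (alpha k) (p k);
  bfgs_y : forall k, y k = g (x k + s k) - g (x k);
  bfgs_H : forall k, H k.+1 = bfgs_update (H k) (s k) (y k);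
  bfgs_x : forall k, x k.+1 = x k + alpha k *: p k
}.

Definition m_hat (R : realType) (m eps_g l : R) : R := m - 2 * eps_g / l.

Definition M_hat (R : realType) (M eps_g l : R) : R := M + 2 * eps_g / l.

Definition beta0 (R : realType) (d : nat) (H0 : 'M[R]_d)
    (m M eps_g l q : R) : R :=
  let B0 := invmx H0 in
  1 / (1 - q) *
  (\tr B0 - ln (\det B0) + M_hat M eps_g l - 1 - ln (m_hat m eps_g l)).

Definition beta1 (R : realType) (d : nat) (H0 : 'M[R]_d)
    (m M eps_g l q : R) : R :=
  expR (- beta0 H0 m M eps_g l q / 2).

Definition constA (R : realType) (c1 c2 : R) : R :=
  Num.max (16 * Num.sqrt 2 / Num.sqrt ((c2 - c1) * (4 - c1 - 3 * c2)))
          (8 / Num.sqrt (c1 * (1 - c2))).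

Definition constB (R : realType) (c1 c2 : R) : R :=
  Num.max (8 / (1 - c2)) (8 * (1 + c1) / (c2 - c1) + 6).

Definition N1 (R : realType) (d : nat) (phi : 'cV[R]_d -> R)
    (M eps_f eps_g c1 c2 b1 : R) : set 'cV[R]_d :=
  [set x | enorm (grad phi x) <=
           Num.max (constA c1 c2 * (Num.sqrt (M * eps_f) / b1))
                   (constB c1 c2 * (eps_g / b1))].

(* min {k | x k \in N}, equal to +oo when the set is empty. *)
Definition first_entry (R : realType) (T : Type) (x : nat -> T) (N : set T)
    : \bar R :=
  ereal_inf [set (k%:R : R)%:E | k in [set k : nat | N (x k)]].

(* Main.v *)
(* Call an iteration good when the cosine of the angle between [p k] and
   [- g (x k)] is at least [beta1].  Lengthening makes every pair [(s, y)]
   satisfy [m_hat |s|^2 <= s.y] and [|y|^2 <= M_hat s.y], and for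
   [B k = invmx (H k)] the quantity [tr B - ln (det B)] is positive and grows
   at each update by at most [M_hat - 1 - ln m_hat] plus the logarithm of the
   squared cosine; hence at least [q k] of the first [k] iterations are good.
   At a good iterate outside [N1], strong convexity gives a point on the search
   ray where [phi] has slope [(c1 + 3 c2) / 4] times [p.g]; the errors are
   small compared with [beta1 |grad phi|], so that point passes the noisy
   Armijo-Wolfe test, and every accepted step decreases [f] by a multiple of
   [|grad phi|^2], which dominates [phi - phi*].  Since [f] never increases,
   [f (x k) - phi* - eps_f] contracts geometrically. *)

Require Import Defs.
From HB Require Import structures.
From mathcomp Require Import all_boot all_order all_algebra.
From mathcomp Require Import all_classical all_reals all_analysis.
From mathcomp Require Import ring lra.

Set Implicit Arguments.
Unset Strict Implicit.
Unset Printing Implicit Defensive.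

Import Order.TTheory GRing.Theory Num.Theory.
Import numFieldNormedType.Exports.

Local Open Scope classical_set_scope.
Local Open Scope ring_scope.

(** * Inner product and Euclidean norm on column vectors *)

Section Euclidean.
Context {R : realType} {d : nat}.
Implicit Types (u v w : 'cV[R]_d) (a : R).

Lemma dotE u v : dot u v = \sum_i u i ord0 * v i ord0.
Proof. by rewrite /dot mxE; apply: eq_bigr => i _; rewrite mxE. Qed.

Lemma mulmx_dot u v : u^T *m v = (dot u v)%:M.
Proof. exact: mx11_scalar. Qed.

Lemma dotC u v : dot u v = dot v u.
Proof. by rewrite !dotE; apply: eq_bigr => i _; rewrite mulrC. Qed.

Lemma dotDl u v w : dot (u + v) w = dot u w + dot v w.
Proof. by rewrite /dot linearD /= mulmxDl mxE. Qed.

Lemma dotZl a u w : dot (a *: u) w = a * dot u w.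
Proof. by rewrite /dot linearZ /= -scalemxAl mxE. Qed.

Lemma dotNl u w : dot (- u) w = - dot u w.
Proof. by rewrite -scaleN1r dotZl mulN1r. Qed.

Lemma dotDr u v w : dot w (u + v) = dot w u + dot w v.
Proof. by rewrite dotC dotDl !(dotC w). Qed.

Lemma dotZr a u w : dot w (a *: u) = a * dot w u.
Proof. by rewrite dotC dotZl (dotC w). Qed.

Lemma dotNr u w : dot w (- u) = - dot w u.
Proof. by rewrite dotC dotNl (dotC w). Qed.

Lemma dot0l u : dot 0 u = 0.
Proof. by rewrite -(scale0r u) dotZl mul0r. Qed.

Definition dot_lin := (dotDl, dotDr, dotNl, dotNr, dotZl, dotZr).

Lemma dot_ge0 u : 0 <= dot u u.
Proof. by rewrite dotE sumr_ge0 // => i _; rewrite -expr2 sqr_ge0. Qed.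

Lemma dot_eq0 u : (dot u u == 0) = (u == 0).
Proof.
apply/eqP/eqP => [|->]; last by rewrite dot0l.
rewrite dotE => /eqP; rewrite psumr_eq0 => [/allP h|i _]; last first.
  by rewrite -expr2 sqr_ge0.
apply/matrixP => i j; rewrite ord1 mxE; apply/eqP.
by have := h i (mem_index_enum i); rewrite /= mulf_eq0 orbb.
Qed.

Lemma dot_gt0 u : (0 < dot u u) = (u != 0).
Proof. by rewrite lt_neqAle dot_ge0 andbT eq_sym dot_eq0. Qed.

Lemma dot_mulmx (A : 'M[R]_d) u v : dot (A *m u) v = dot u (A^T *m v).
Proof. by rewrite /dot trmx_mul mulmxA. Qed.

Lemma enorm_ge0 u : 0 <= enorm u.
Proof. exact: sqrtr_ge0. Qed.

Lemma enorm_sqr u : enorm u ^+ 2 = dot u u.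
Proof. by rewrite sqr_sqrtr ?dot_ge0. Qed.

Lemma enorm_gt0 u : (0 < enorm u) = (u != 0).
Proof. by rewrite sqrtr_gt0 dot_gt0. Qed.

Lemma enormZ a u : enorm (a *: u) = `|a| * enorm u.
Proof.
by rewrite /enorm !dot_lin mulrA -expr2 sqrtrM ?sqr_ge0 // sqrtr_sqr.
Qed.

Lemma enormN u : enorm (- u) = enorm u.
Proof. by rewrite -scaleN1r enormZ normrN1 mul1r. Qed.

(** Cauchy-Schwarz: expand the square of [enorm v *: u - enorm u *: v], then divide by
    [enorm u * enorm v] once both vectors are nonzero. *)
Lemma dot_le u v : dot u v <= enorm u * enorm v.
Proof.
have [->|v0] := eqVneq v 0; first by rewrite dotC dot0l mulr_ge0 ?enorm_ge0.
have [/eqP|u0] := eqVneq u 0.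
  by move=> /eqP ->; rewrite dot0l mulr_ge0 ?enorm_ge0.
have := dot_ge0 (enorm v *: u - enorm u *: v); rewrite !dot_lin.
rewrite -!enorm_sqr (dotC v u) => h.
have uv : 0 < enorm u * enorm v by rewrite mulr_gt0 ?enorm_gt0.
by rewrite -(ler_pM2l uv); nra.
Qed.

Lemma dot_geN u v : - (enorm u * enorm v) <= dot u v.
Proof. by have := dot_le (- u) v; rewrite dotNl enormN lerNl. Qed.

Lemma enormD u v : enorm (u + v) <= enorm u + enorm v.
Proof.
rewrite -ler_sqr ?nnegrE ?addr_ge0 ?enorm_ge0 // enorm_sqr !dot_lin.
by rewrite -!enorm_sqr (dotC v u); have := dot_le u v; nra.
Qed.

Lemma enormB u v : enorm (u - v) <= enorm u + enorm v.
Proof. by rewrite (le_trans (enormD _ _)) // enormN. Qed.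

Lemma enormC u v : enorm (u - v) = enorm (v - u).
Proof. by rewrite -enormN opprB. Qed.

End Euclidean.

(** * Positive definite matrices and determinant identities *)

Section PosDef.
Context {R : realType}.

Lemma dot_col_mx n1 n2 (u1 v1 : 'cV[R]_n1) (u2 v2 : 'cV[R]_n2) :
  dot (col_mx u1 u2) (col_mx v1 v2) = dot u1 v1 + dot u2 v2.
Proof. by rewrite /dot tr_col_mx mul_row_col mxE. Qed.

(* Schur complement: the trace decreases and the determinant factors, so
   [ln x <= x - 1] can be applied one pivot at a time. *)
Lemma posdef_ln_det n (B : 'M[R]_n) : sym_posdef B ->
  0 < \det B /\ ln (\det B) <= \tr B - n%:R.
Proof.
elim: n B => [|n IHn] B.
  move=> _; rewrite det_mx00 ln1 ltr01 subr0; split=> //.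
  by rewrite /mxtrace big_ord0.
rewrite -[n.+1]/(1 + n)%N in B *.
move=> [Bsym Bpos].
set a := ulsubmx B 0 0; set b := dlsubmx B; set C := drsubmx B.
have defB : B = block_mx a%:M b^T b C.
  by rewrite -[LHS]submxK -(mx11_scalar (ulsubmx B)) trmx_dlsub Bsym.
have Csym : C^T = C by rewrite /C trmx_drsub Bsym.
have a_gt0 : 0 < a.
  have : 0 < dot (col_mx 1%:M 0 : 'cV[R]_(1 + n)) (B *m col_mx 1%:M 0).
    apply: Bpos; apply/eqP => /(congr1 usubmx).
    rewrite col_mxKu => /matrixP /(_ 0 0); rewrite !mxE eqxx => /eqP.
    by rewrite oner_eq0.
  rewrite defB mul_block_col dot_col_mx dot0l addr0 mulmx1 mulmx0 addr0.
  by rewrite /dot trmx1 mul1mx mxE eqxx mulr1n.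
have a0 : a != 0 by rewrite gt_eqF.
set S := C - a^-1 *: (b *m b^T).
have Spos : sym_posdef S.
  split=> [|v v0].
    by rewrite /S linearB linearZ /= trmx_mul trmxK Csym.
  (* For fixed [v] this first coordinate minimizes the quadratic form of [B]; the minimum is the
     form of [S] at [v]. *)
  set w : 'cV[R]_(1 + n) := col_mx (- (a^-1 * dot b v))%:M v.
  have w0 : w != 0.
    apply: contraNneq v0 => /(congr1 dsubmx).
    by rewrite col_mxKd => ->; apply/eqP/matrixP => i j; rewrite !mxE.
  have := Bpos _ w0; rewrite defB /w mul_block_col dot_col_mx mulmx_dot.
  have -> : a%:M *m (- (a^-1 * dot b v))%:M + (dot b v)%:M = 0 :> 'M[R]_1.
    by rewrite -scalar_mxM -raddfD /= mulrN mulrA divff // mul1r addNr raddf0.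
  rewrite dotC dot0l add0r; congr (0 < dot _ _).
  rewrite /S mulmxBl mul_mx_scalar -scalemxAl -mulmxA mulmx_dot mul_mx_scalar.
  by rewrite scalerA addrC scaleNr.
have [dS_gt0 dS_le] := IHn S Spos.
have detB : \det B = a * \det S.
  have -> : B = block_mx 1%:M 0 (a^-1 *: b) 1%:M *m block_mx a%:M b^T 0 S.
    rewrite mulmx_block !mul1mx !mul0mx !addr0 mul_mx_scalar scalerA.
    by by rewrite divff // scale1r -scalemxAl /S [_ + (C - _)]addrC subrK defB.
  by rewrite det_mulmx det_lblock det_ublock !det1 !mul1r det_scalar1.
rewrite detB mulr_gt0 //; split=> //.
rewrite lnM ?posrE //.
have ln_a : ln a <= a - 1.
  have := @le_ln1Dx _ (a - 1); rewrite [1 + _]addrC subrK; apply.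
  by rewrite ltrBrDr addNr.
have tr_bb : 0 <= \tr (a^-1 *: (b *m b^T)).
  by rewrite mxtraceZ mxtrace_mulC trace_mx11 mulr_ge0 ?invr_ge0
    ?(ltW a_gt0) ?dot_ge0.
have trB : \tr B = a + \tr C by rewrite {1}defB mxtrace_block mxtrace_scalar.
have : \tr S = \tr C - \tr (a^-1 *: (b *m b^T)) by rewrite /S linearB.
rewrite trB natrD; lra.
Qed.

Lemma posdef_unit n (B : 'M[R]_n) : sym_posdef B -> B \in unitmx.
Proof.
by move=> /posdef_ln_det[detB _]; rewrite unitmxE unitfE gt_eqF.
Qed.

Lemma posdef_inv n (B : 'M[R]_n) : sym_posdef B -> sym_posdef (invmx B).
Proof.
move=> Bpos; have Bu := posdef_unit Bpos; case: Bpos => Bsym Bpos.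
split=> [|v v0]; first by rewrite trmx_inv Bsym.
have w0 : invmx B *m v != 0.
  by apply: contraNneq v0 => h; rewrite -(mulKVmx Bu v) h mulmx0.
by have := Bpos _ w0; rewrite mulKVmx // dotC.
Qed.

Lemma posdef_dotC n (B : 'M[R]_n) u v :
  sym_posdef B -> dot u (B *m v) = dot v (B *m u).
Proof. by case=> Bsym _; rewrite dotC dot_mulmx Bsym. Qed.

(** Sylvester's identity: the same block matrix is factored into block triangular matrices in two
    ways. *)
Lemma det_1D_mulC n k (U : 'M[R]_(n, k)) (V : 'M[R]_(k, n)) :
  \det (1%:M + U *m V) = \det (1%:M + V *m U).
Proof.
have <- : \det (block_mx 1%:M (- U) V 1%:M) = \det (1%:M + U *m V).
  have -> : block_mx 1%:M (- U) V 1%:M =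
      block_mx (1%:M + U *m V) (- U) 0 1%:M *m block_mx 1%:M 0 V 1%:M.
    by rewrite mulmx_block !mulmx1 !mulmx0 !mul1mx !add0r mulNmx addrK.
  by rewrite det_mulmx det_ublock det_lblock !det1 !mulr1.
have -> : block_mx 1%:M (- U) V 1%:M =
    block_mx 1%:M 0 V 1%:M *m block_mx 1%:M (- U) 0 (1%:M + V *m U).
  rewrite mulmx_block !mulmx1 !mul0mx !mul1mx !addr0 mulmxN.
  by rewrite [_%:M + _ *m _]addrC addKr.
by rewrite det_mulmx det_ublock det_lblock !det1 !mul1r.
Qed.

(** The indices are built from [lshift] and [rshift] so that the entries of a [block_mx] can be read
    off. *)
Lemma det_mx2 (A : 'M[R]_(1 + 1)) : let i : 'I_(1 + 1) := lshift 1 ord0 in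
  let j : 'I_(1 + 1) := rshift 1 ord0 in
  \det A = A i i * A j j - A i j * A j i.
Proof.
have e0 : (0 : 'I_(1 + 1)) = lshift 1 ord0 by apply: val_inj.
have e1 : lift 0 ord0 = rshift 1 ord0 :> 'I_(1 + 1) by apply: val_inj.
have e2 : lift (rshift 1 ord0) 0 = lshift 1 ord0 :> 'I_(1 + 1).
  exact: val_inj.
rewrite (expand_det_row _ 0) !big_ord_recl big_ord0 /cofactor !det_mx11.
have e3 : ord0 = lshift 1 ord0 :> 'I_(1 + 1) by apply: val_inj.
rewrite !mxE !e1 e2 e0 /= /bump /= e3 [(0 + (1 + 0))%N]/= expr0 expr1; ring.
Qed.

End PosDef.

(** * The BFGS update: inverse form, definiteness, trace and determinant *)

Section BFGS.
Context {R : realType} {d : nat}.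
Implicit Types (H B : 'M[R]_d) (s y : 'cV[R]_d).

(** The BFGS formula for the Hessian approximation, inverse to [bfgs_update]; trace and determinant
    are explicit in this form. *)
Definition bfgs_direct_update B s y : 'M[R]_d :=
  B - (dot s (B *m s))^-1 *: ((B *m s) *m (B *m s)^T)
  + (dot s y)^-1 *: (y *m y^T).

Lemma bfgs_updateK H s y : sym_posdef H -> 0 < dot s y ->
  bfgs_update H s y *m bfgs_direct_update (invmx H) s y = 1%:M.
Proof.
move=> Hpos sy; have Hu := posdef_unit Hpos.
have [Bsym Bpos] := posdef_inv Hpos.
have s0 : s != 0 by apply: contraTneq sy => ->; rewrite dot0l ltxx.
rewrite /bfgs_update /bfgs_direct_update.
set B := invmx H in Bsym Bpos *.
set t := B *m s; set r := (dot s y)^-1.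
have st0 : dot s t != 0 by rewrite gt_eqF // Bpos.
have rs : r * dot s y = 1 by rewrite mulVf // gt_eqF.
set E := B - _.
(* [E] is annihilated by [s]; this yields the secant equation [sB'], after which only rank-one terms
   that cancel remain. *)
have sE : s^T *m E = 0.
  rewrite mulmxBr -scalemxAr mulmxA mulmx_dot mul_scalar_mx scalerA mulVf //.
  by rewrite scale1r /t trmx_mul Bsym subrr.
have sB' : s^T *m (E + r *: (y *m y^T)) = y^T.
  rewrite mulmxDr sE add0r -scalemxAr mulmxA mulmx_dot mul_scalar_mx scalerA.
  by rewrite rs scale1r.
rewrite [LHS]mulmxDl -[(r *: (s *m s^T)) *m _]scalemxAl.
rewrite -[s *m s^T *m _]mulmxA sB' -!mulmxA.
have -> : (1%:M - r *: (y *m s^T)) *m (E + r *: (y *m y^T)) = E.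
  by rewrite mulmxBl mul1mx -scalemxAl -mulmxA sB' addrK.
have -> : H *m E = 1%:M - (dot s t)^-1 *: (s *m t^T).
  by rewrite mulmxBr mulmxV // -scalemxAr mulmxA /t mulKVmx.
rewrite mulmxBl mul1mx -scalemxAl mulmxBr mulmx1 -scalemxAr mulmxA.
rewrite -(mulmxA s) mulmx_dot mul_mx_scalar dotC -scalemxAl.
rewrite scalerBr !scalerA (dotC y) mulrCA rs mulr1.
by rewrite opprB addrA addrNK subrK.
Qed.

Lemma bfgs_update_inv H s y : sym_posdef H -> 0 < dot s y ->
  invmx (bfgs_update H s y) = bfgs_direct_update (invmx H) s y.
Proof.
move=> Hpos sy; have h := bfgs_updateK Hpos sy.
have [Hu _] := mulmx1_unit h.
by rewrite -[LHS]mulmx1 -h mulKmx.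
Qed.

(** The form at [v] is that of [H] at [w = v - r (s.v) y] plus [r (s.v)^2]. If [s.v = 0] then
    [w = v]; otherwise the second term is positive. *)
Lemma posdef_bfgs_update H s y : sym_posdef H -> 0 < dot s y ->
  sym_posdef (bfgs_update H s y).
Proof.
move=> [Hsym Hpos] sy; rewrite /bfgs_update; set r := (dot s y)^-1.
have r_gt0 : 0 < r by rewrite invr_gt0.
have Wtr : (1%:M - r *: (s *m y^T))^T = 1%:M - r *: (y *m s^T).
  by rewrite linearB linearZ /= trmx_mul trmxK trmx1.
split=> [|v v0].
  have sst : (r *: (s *m s^T))^T = r *: (s *m s^T).
    by rewrite linearZ /= trmx_mul trmxK.
  by rewrite raddfD /= sst !trmx_mul Hsym Wtr -Wtr trmxK mulmxA.
set w := (1%:M - r *: (y *m s^T)) *m v.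
have -> : dot v (((1%:M - r *: (s *m y^T)) *m H *m (1%:M - r *: (y *m s^T))
    + r *: (s *m s^T)) *m v) = dot w (H *m w) + r * dot s v ^+ 2.
  rewrite mulmxDl dotDr -!mulmxA -/w; congr (_ + _).
    by rewrite dotC dot_mulmx Wtr -/w dotC.
  rewrite -scalemxAl dotZr -mulmxA mulmx_dot mul_mx_scalar dotZr (dotC v s).
  by rewrite expr2.
have [sv0|sv0] := eqVneq (dot s v) 0.
  rewrite sv0 expr0n /= mulr0 addr0; apply: Hpos.
  rewrite /w mulmxBl mul1mx -scalemxAl -mulmxA mulmx_dot sv0 mul_mx_scalar.
  by rewrite scale0r scaler0 subr0.
have w_ge0 : 0 <= dot w (H *m w).
  have [->|w0] := eqVneq w 0; first by rewrite dot0l.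
  by rewrite ltW // Hpos.
by rewrite ltr_wpDl // mulr_gt0 // exprn_even_gt0.
Qed.

Lemma tr_bfgs_direct_update B s y :
  \tr (bfgs_direct_update B s y) =
  \tr B - dot (B *m s) (B *m s) / dot s (B *m s) + dot y y / dot s y.
Proof.
rewrite /bfgs_direct_update raddfD /= raddfB /= !mxtraceZ.
by rewrite !(mxtrace_mulC _ (_^T)) !trace_mx11 !(mulrC _^-1).
Qed.

(** Factoring out [B] leaves a rank-two perturbation of the identity, which [det_1D_mulC] turns into
    a 2 by 2 determinant whose upper left entry is zero. *)
Lemma det_bfgs_direct_update B s y : sym_posdef B -> s != 0 -> 0 < dot s y ->
  \det (bfgs_direct_update B s y) = \det B * (dot s y / dot s (B *m s)).
Proof.
move=> Bpos s0 sy; have Bu := posdef_unit Bpos.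
set t := B *m s; set h := invmx B *m y.
have st0 : dot s t != 0 by rewrite gt_eqF // (proj2 Bpos).
have -> : bfgs_direct_update B s y = B *m (1%:M +
    row_mx s h *m col_mx (- ((dot s t)^-1 *: t^T)) ((dot s y)^-1 *: y^T)).
  rewrite mul_row_col mulmxDr mulmx1 mulmxDr !mulmxA -/t mulmxV // mul1mx.
  by rewrite mulmxN -!scalemxAr addrA.
rewrite det_mulmx det_1D_mulC mul_col_row; congr (_ * _).
have ht : dot t h = dot s y.
  by rewrite (posdef_dotC _ _ (posdef_inv Bpos)) /t mulKmx // dotC.
rewrite !mulNmx -!scalemxAl !mulmx_dot (scalar_mx_block 1 1) add_block_mx.
rewrite det_mx2 block_mxEul block_mxEdr block_mxEur block_mxEdl !mxE /=.
rewrite !mulr1n ht (dotC y s) (dotC t s) mulVf // subrr mul0r !add0r.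
by rewrite mulVf ?gt_eqF // mulr1 opprK mulrC.
Qed.

End BFGS.

(** * Gradients and derivatives along lines *)

Section Gradient.
Context {R : realType} {d : nat}.
Implicit Types (phi : 'cV[R]_d -> R) (x v : 'cV[R]_d).

Lemma derive_grad phi x v : differentiable phi x ->
  'D_v phi x = dot (grad phi x) v.
Proof.
move=> dphi; rewrite deriveE //.
have -> : v = \sum_i v i ord0 *: basis_vec R i.
  rewrite [LHS]matrix_sum_delta; apply: eq_bigr => i _.
  by rewrite big_ord_recl big_ord0 addr0.
rewrite linear_sum dotC dotE; apply: eq_bigr => i _.
rewrite linearZ /= [grad _ _ _ _]mxE deriveE // summxE (bigD1 i) //=.
rewrite big1 ?addr0 => [|j ji]; first by rewrite !mxE !eqxx mulr1.
by rewrite !mxE eq_sym (negPf ji) mulr0.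
Qed.

Lemma is_derive_line phi x v (t : R) : differentiable phi (x + t *: v) ->
  is_derive t 1 (fun t => phi (x + t *: v)) (dot (grad phi (x + t *: v)) v).
Proof.
move=> dphi.
have E : (fun h : R => h^-1 *:
      (((fun t => phi (x + t *: v)) \o shift t) (h *: 1)
      - phi (x + t *: v))) =
    (fun h : R => h^-1 *: ((phi \o shift (x + t *: v)) (h *: v)
      - phi (x + t *: v))).
  apply/funext => h /=; congr (_ *: (phi _ - _)).
  by rewrite scalerDl [h *: 1]mulr1 addrCA.
apply: DeriveDef.
  by rewrite /derivable E; exact: diff_derivable.
by rewrite -derive_grad // /derive E.
Qed.

(** Stands in for integration over [[0, 1]]: the mean value theorem is applied to [h] minus the
    primitive of the affine bound. *)
Lemma le_is_derive_affine (h dh : R -> R) (K : R) :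
  (forall t : R, is_derive t 1 h (dh t)) ->
  (forall t, 0 <= t <= 1 -> dh t <= dh 0 + K * t) ->
  h 1 - h 0 <= dh 0 + K / 2.
Proof.
move=> hd dhK.
pose F := fun t => h t - (t * dh 0 + K / 2 * t ^+ 2).
have Fd (t : R) : is_derive t 1 F (dh t - (dh 0 + K * t)).
  by apply: is_derive_eq; rewrite /GRing.scale /=; field.
have [||c c01] := @MVT_segment R F (fun t => dh t - (dh 0 + K * t)) 0 1.
- exact: ler01.
- by apply: derivable_within_continuous => t _; apply: ex_derive.
rewrite in_itv /= in c01; clear hd Fd; have := dhK c c01; rewrite /F; lra.
Qed.

End Gradient.

(** * Quadratic bounds and cocoercivity for smooth strongly convex functions *)

Section Smooth.
Context {R : realType} {d : nat}.
Variables (phi : 'cV[R]_d -> R) (m M : R).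
Hypothesis phi_diff : forall x, differentiable phi x.
Hypothesis M_gt0 : 0 < M.
Hypothesis phi_lip : lipschitz_gradient M phi.
Implicit Types (x v w : 'cV[R]_d).

Lemma grad_line_le x v (t : R) : 0 <= t ->
  `|dot (grad phi (x + t *: v) - grad phi x) v| <= M * t * dot v v.
Proof.
move=> t0; have := phi_lip (x + t *: v) x.
rewrite [x + _ - x]addrAC subrr add0r enormZ (ger0_norm t0) => h.
have vv := enorm_sqr v; have v0 := enorm_ge0 v.
have := dot_le (grad phi (x + t *: v) - grad phi x) v.
have := dot_geN (grad phi (x + t *: v) - grad phi x) v.
by move=> h1 h2; rewrite ler_norml -vv; apply/andP; split; nra.
Qed.

(** Along the segment the affine slope bound holds for both [phi] and [- phi]. The lower half serves
    [strongly_convex_grad], the upper half [cocoercive_half]. *)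
Lemma descent x v :
  `|phi (x + v) - phi x - dot (grad phi x) v| <= M / 2 * dot v v.
Proof.
have hd (t : R) := @is_derive_line R d phi x v t (phi_diff _).
have K t : 0 <= t <= 1 -> _ := fun t01 : 0 <= t <= 1 =>
  @grad_line_le x v t (proj1 (andP t01)).
have up := @le_is_derive_affine R (fun t => phi (x + t *: v))
  (fun t => dot (grad phi (x + t *: v)) v) (M * dot v v) hd.
have dn := @le_is_derive_affine R (fun t => - phi (x + t *: v))
  (fun t => - dot (grad phi (x + t *: v)) v) (M * dot v v)
  (fun t => is_deriveN (hd t)).
rewrite /= scale0r scale1r addr0 in up dn.
have {}up := up _; have {}dn := dn _.
rewrite ler_norml; apply/andP; split.
  have /dn : forall t : R, 0 <= t <= 1 ->
     - dot (grad phi (x + t *: v)) v <= - dot (grad phi x) v + M * dot v v * t.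
    by move=> t /K; rewrite dotDl dotNl ler_norml => /andP[]; nra.
  by nra.
have /up : forall t : R, 0 <= t <= 1 ->
    dot (grad phi (x + t *: v)) v <= dot (grad phi x) v + M * dot v v * t.
  by move=> t /K; rewrite dotDl dotNl ler_norml => /andP[]; nra.
by nra.
Qed.

Hypothesis m_gt0 : 0 < m.
Hypothesis phi_convex : strongly_convex m phi.

(* The descent lemma replaces the limit [t -> 0] by an explicit error. *)
Lemma strongly_convex_grad x v :
  phi x + dot (grad phi x) v + m / 2 * dot v v <= phi (x + v).
Proof.
apply/ler_addgt0Pr => e e0; have V0 := dot_ge0 v.
set V := dot v v in V0 *.
(* Ensures [t (M + m) V <= e], which covers the error [(M + m) / 2 * t * V] left after division by
   [t]; the summand [e] keeps the denominator positive when [V = 0]. *)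
pose t := e / (e + (M + m) * V).
have MV : 0 <= (M + m) * V by rewrite mulr_ge0 // addr_ge0 // ltW.
have den : 0 < e + (M + m) * V by rewrite ltr_wpDr.
have t_gt0 : 0 < t by rewrite divr_gt0.
have tE : t * (e + (M + m) * V) = e by rewrite mulfVK // gt_eqF.
have t01 : 0 <= t <= 1 by rewrite (ltW t_gt0) /= ler_pdivrMr // mul1r; lra.
have := phi_convex (x + v) x t01.
have -> : t *: (x + v) + (1 - t) *: x = x + t *: v.
  by rewrite scalerDr scalerBl scale1r addrAC addrCA subrr addr0.
rewrite [x + v]addrC addrK enorm_sqr [v + x]addrC -/V.
have := descent x (t *: v); rewrite ler_norml !dot_lin -/V => /andP[h _] h2.
by rewrite -(ler_pM2l t_gt0); nra.
Qed.

(** [E] is the gradient increment of [phi - m/2 |.|^2]. At [x + v - t E] the upper quadratic bound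
    from [x + v] meets the strong convexity bound from [x]. Leaving [t] free covers the case
    [m = M]. *)
Lemma cocoercive_half x v (t : R) :
  let E := grad phi (x + v) - grad phi x - m *: v in
  ((t - (M - m) / 2 * t ^+ 2) * dot E E <=
  phi (x + v) - phi x - dot (grad phi x) v - m / 2 * dot v v : Prop).
Proof.
move=> E; pose w := - t *: E.
have Ew : dot E w = - t * dot E E by rewrite dotZr.
have ww : dot w w = t ^+ 2 * dot E E by rewrite dotZl dotZr; ring.
move: (dot E E) Ew ww => EE Ew ww.
have := descent (x + v) w; rewrite ler_norml ww => /andP[_ h1].
have := strongly_convex_grad x (v + w).
rewrite addrA dotDr dotDl (dotDr _ w v) (dotDr v w w) (dotC w v) ww => h2.
by move: Ew; rewrite /E !dotDl !dotNl dotZl; nra.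
Qed.

(** Adding [cocoercive_half] from both ends of the segment cancels the values of [phi]; for [m < M]
    the best choice is [t = 1 / (M - m)]. *)
Lemma cocoercive x v : m <= M ->
  let D := grad phi (x + v) - grad phi x in
  (dot (D - m *: v) (D - M *: v) <= 0 : Prop).
Proof.
move=> mM D; set E := D - m *: v.
have H t : (2 * t - (M - m) * t ^+ 2) * dot E E <= dot E v.
  have h1 := cocoercive_half x v t.
  have := cocoercive_half (x + v) (- v) t.
  rewrite /= addrK scalerN opprK.
  have -> : grad phi x - grad phi (x + v) + m *: v = - E.
    by rewrite /E /D !opprD !opprK [_ + grad phi x]addrC.
  rewrite /= -/D -/E in h1.
  rewrite !(dotNl, dotNr) !opprK => h2.
  have Ev : dot E v =
      dot (grad phi (x + v)) v - dot (grad phi x) v - m * dot v v.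
    by rewrite /E /D !dotDl !dotNl dotZl.
  rewrite Ev; move: (dot E E) h1 h2 => EE h1 h2; lra.
have -> : D - M *: v = E - (M - m) *: v.
  by rewrite /E scalerBl opprB addrA subrK.
rewrite dotDr dotNr dotZr.
have [mM'|mM'] := eqVneq m M.
  rewrite mM' subrr mul0r subr0.
  case: (ltrP 0 (dot E E)) => // EE.
  (* For [m = M], [H] bounds [2 t |E|^2] by [dot E v] for every [t]; this [t] makes the left side
     [dot E v + 1], a contradiction. *)
  have := H ((dot E v + 1) / (2 * dot E E)); rewrite mM' subrr mul0r subr0.
  have -> : 2 * ((dot E v + 1) / (2 * dot E E)) * dot E E = dot E v + 1.
    by field; rewrite gt_eqF.
  lra.
have L : 0 < M - m by rewrite subr_gt0 lt_neqAle mM'.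
have := H (M - m)^-1.
have -> : 2 * (M - m)^-1 - (M - m) * (M - m)^-1 ^+ 2 = (M - m)^-1.
  by field; rewrite gt_eqF.
by rewrite -(ler_pM2l L) mulrA divff ?gt_eqF // mul1r subr_le0.
Qed.

End Smooth.

(** * Curvature of noisy pairs and the trace-determinant potential *)

Section Curvature.
Context {R : realType} {d : nat}.
Implicit Types (s y D : 'cV[R]_d).

(* [(D - m s).(D - M s) <= 0] says that [D] lies in the ball of centre
   [(M + m)/2 s] and radius [(M - m)/2 |s|]; an error of size [delta |s|]
   enlarges that ball into the one attached to [m - delta] and [M + delta]. *)
Lemma noisy_curvature (m M delta : R) s y D :
  m <= M -> delta < m -> 0 <= delta ->
  dot (D - m *: s) (D - M *: s) <= 0 ->
  enorm (y - D) <= delta * enorm s ->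
  (m - delta) * dot s s <= dot s y /\ dot y y <= (M + delta) * dot s y.
Proof.
move=> mM dm d0 coco err.
set c := (M + m) / 2; set r := (M - m) / 2 + delta.
have n0 := enorm_ge0 s.
have ballD : enorm (D - c *: s) <= (M - m) / 2 * enorm s.
  have r0 : 0 <= (M - m) / 2 by lra.
  have r1 : 0 <= (M - m) / 2 * enorm s by exact: mulr_ge0.
  rewrite -ler_sqr ?nnegrE ?enorm_ge0 // exprMn !enorm_sqr.
  move: coco; rewrite !dotDl !dotNl !dotZl !(dotDr _ _ D) !(dotDr _ _ s).
  rewrite !dotNr !dotZr (dotC s D) /c; nra.
have bally : enorm (y - c *: s) <= r * enorm s.
  have -> : y - c *: s = (y - D) + (D - c *: s) by rewrite addrA subrK.
  by rewrite (le_trans (enormD _ _)) // /r; lra.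
have r0 : 0 <= r by rewrite /r; lra.
have sq : dot y y - 2 * c * dot s y + c ^+ 2 * dot s s <= r ^+ 2 * dot s s.
  rewrite -(enorm_sqr s) -[leRHS]exprMn.
  have <- : enorm (y - c *: s) ^+ 2 =
      dot y y - 2 * c * dot s y + c ^+ 2 * enorm s ^+ 2.
    by rewrite !enorm_sqr !dot_lin (dotC y s); ring.
  by rewrite ler_sqr // nnegrE ?enorm_ge0 // mulr_ge0.
have sy : dot s (y - c *: s) = dot s y - c * dot s s by rewrite !dot_lin.
have lo := dot_geN s (y - c *: s); have up := dot_le s (y - c *: s).
have ball2 : enorm s * enorm (y - c *: s) <= r * dot s s.
  by rewrite -enorm_sqr expr2 mulrCA ler_wpM2l.
have sy_lo : (m - delta) * dot s s <= dot s y.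
  by have : c - r = m - delta; [rewrite /c /r; lra | nra].
have sy_up : dot s y <= (M + delta) * dot s s.
  by have : c + r = M + delta; [rewrite /c /r; lra | nra].
split=> //.
have key : r ^+ 2 - c ^+ 2 = - ((m - delta) * (M + delta)).
  by rewrite /r /c; field.
have {}sq : dot y y <=
    (M + m) * dot s y - (m - delta) * ((M + delta) * dot s s).
  have : dot y y <= 2 * c * dot s y + (r ^+ 2 - c ^+ 2) * dot s s by lra.
  by rewrite key; have -> : 2 * c = M + m; [rewrite /c; field | lra].
(* Added to [sq], this product trades [(m - delta) (M + delta) |s|^2] for [(m - delta) s.y], and
   [M + m - (m - delta) = M + delta]. *)
have : 0 <= (m - delta) * ((M + delta) * dot s s - dot s y).
  by rewrite mulr_ge0 // subr_ge0 // ltW.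
nra.
Qed.

(** The Byrd-Nocedal potential; minus [d], it is the log-determinant divergence of [B] from the
    identity. *)
Definition lndet_gap (B : 'M[R]_d) : R := \tr B - ln (\det B).

Lemma lndet_gap_ge (B : 'M[R]_d) : sym_posdef B -> d%:R <= lndet_gap B.
Proof. by move=> /posdef_ln_det[_]; rewrite /lndet_gap; lra. Qed.

(** The update adds [|y|^2 / s.y - |t|^2 / s.t] to the trace and [ln (s.y / s.t)] to the
    log-determinant. Applying [ln u <= u - 1] at [u = |t|^2 / s.t] turns the trace loss into
    logarithms, which assemble into the squared cosine between [s] and [t]. *)
Lemma lndet_gap_update (H : 'M[R]_d) s y (mh Mh : R) :
  sym_posdef H -> s != 0 -> 0 < mh ->
  mh * dot s s <= dot s y -> dot y y <= Mh * dot s y ->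
  let t := invmx H *m s in
  (lndet_gap (invmx (bfgs_update H s y)) <= lndet_gap (invmx H) + Mh - 1 - ln mh
    + ln (dot s t ^+ 2 / (dot s s * dot t t)) : Prop).
Proof.
move=> Hpos s0 mh0 lo up t.
have ss : 0 < dot s s by rewrite dot_gt0.
have sy : 0 < dot s y by rewrite (lt_le_trans _ lo) // mulr_gt0.
have Bpos := posdef_inv Hpos.
have st : 0 < dot s t by exact: (proj2 Bpos).
have t0 : t != 0 by apply: contraTneq st => ->; rewrite dotC dot0l ltxx.
have tt : 0 < dot t t by rewrite dot_gt0.
have [detB _] := posdef_ln_det Bpos.
rewrite /lndet_gap bfgs_update_inv // tr_bfgs_direct_update.
rewrite det_bfgs_direct_update // -/t.
rewrite [ln (\det _ * _)]lnM ?posrE ?divr_gt0 //.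
rewrite !ln_div ?posrE ?exprn_gt0 ?mulr_gt0 // lnXn // lnM ?posrE //.
have yy : dot y y / dot s y <= Mh by rewrite ler_pdivrMr.
have lnsy : ln mh + ln (dot s s) <= ln (dot s y).
  by rewrite -lnM ?posrE // ler_ln ?posrE ?mulr_gt0.
have : ln (dot t t) - ln (dot s t) <= dot t t / dot s t - 1.
  rewrite -ln_div ?posrE //.
  have := @le_ln1Dx _ (dot t t / dot s t - 1); rewrite [1 + _]addrC subrK.
  by apply; rewrite ltrBrDr addNr divr_gt0.
rewrite mulr2n; lra.
Qed.

End Curvature.

(** * Success of the line search and the decrease it brings *)

Section LineSearch.
Context {R : realType} {d : nat}.
Variables (phi : 'cV[R]_d -> R) (m M : R).
Hypothesis phi_diff : forall x, differentiable phi x.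
Hypothesis M_gt0 : 0 < M.
Hypothesis phi_lip : lipschitz_gradient M phi.
Hypothesis m_gt0 : 0 < m.
Hypothesis phi_convex : strongly_convex m phi.
Implicit Types (x p v : 'cV[R]_d).

Lemma strongly_monotone_grad x v :
  m * dot v v <= dot (grad phi (x + v) - grad phi x) v.
Proof.
have h1 := strongly_convex_grad phi_diff M_gt0 phi_lip m_gt0 phi_convex x v.
have := strongly_convex_grad phi_diff M_gt0 phi_lip m_gt0 phi_convex
  (x + v) (- v).
by rewrite addrK !(dotNr, dotNl, dotDl) opprK; nra.
Qed.

Lemma dot_grad_line_continuous x p :
  continuous (fun t : R => dot (grad phi (x + t *: p)) p).
Proof.
move=> t; apply/cvgrPdist_le => e e0.
(* The added 1 keeps [K] positive when [p = 0]. *)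
set K := M * dot p p + 1.
have K0 : 0 < K by rewrite ltr_wpDl // mulr_ge0 ?dot_ge0 // ltW.
near=> u.
have tu : `|t - u| <= e / K by near: u; apply: cvgr_dist_le; rewrite ?divr_gt0.
rewrite -dotNl -dotDl.
have lip := phi_lip (x + t *: p) (x + u *: p).
have n := enorm_ge0 p; have pp := enorm_sqr p.
have lip' : enorm (grad phi (x + t *: p) - grad phi (x + u *: p))
    <= M * (e / K * enorm p).
  rewrite (le_trans lip) // ler_pM2l // opprD addrACA subrr add0r -scalerBl.
  by rewrite enormZ ler_wpM2r.
have up := dot_le (grad phi (x + t *: p) - grad phi (x + u *: p)) p.
have lo := dot_geN (grad phi (x + t *: p) - grad phi (x + u *: p)) p.
have bound :
    enorm (grad phi (x + t *: p) - grad phi (x + u *: p)) * enorm p <= e.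
  rewrite (le_trans (ler_wpM2r n lip')) // -!mulrA -expr2 pp.
  rewrite mulrCA mulrA -[leRHS]mulr1.
  have : M * dot p p / K <= 1 by rewrite ler_pdivrMr // mul1r /K; lra.
  by move=> h; rewrite -!mulrA ler_pM2l // mulrC -mulrA mulrCA in h *; lra.
by rewrite ler_norml; apply/andP; split; lra.
Unshelve. all: by end_near. Qed.

(** By strong monotonicity the slope rises at rate at least [m |p|^2], so it is nonnegative at [T];
    the intermediate value theorem then applies on [[0, T]]. *)
Lemma slope_attained x p (w : R) : p != 0 ->
  dot (grad phi x) p < - w -> 0 <= w ->
  exists2 a : R, 0 < a & dot (grad phi (x + a *: p)) p = - w.
Proof.
move=> p0 slope w0; set b := - dot (grad phi x) p.
have b0 : 0 < b by rewrite /b; lra.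
have pp : 0 < dot p p by rewrite dot_gt0.
pose T := b / (m * dot p p).
have mpp : 0 < m * dot p p by rewrite mulr_gt0.
have T0 : 0 < T by rewrite divr_gt0.
have TE : T * (m * dot p p) = b by rewrite mulfVK // gt_eqF.
have slopeT : 0 <= dot (grad phi (x + T *: p)) p.
  have := strongly_monotone_grad x (T *: p).
  rewrite dotZl !dotZr dotDl dotNl mulrCA ler_pM2l // mulrCA TE /b; lra.
have [|||a] := @IVT R (fun t => dot (grad phi (x + t *: p)) p) 0 T (- w).
- exact: ltW.
- apply: continuous_subspaceT; exact: dot_grad_line_continuous.
- rewrite scale0r addr0 ge_min le_max (ltW slope) /=.
  by rewrite (le_trans _ slopeT) ?orbT // oppr_le0.
rewrite in_itv /= => /andP[a0 _] aw; exists a => //.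
rewrite lt_neqAle a0 andbT eq_sym; apply/eqP => a00.
by move: slope; rewrite -aw a00 scale0r addr0 ltxx.
Qed.

Variables (f : 'cV[R]_d -> R) (g : 'cV[R]_d -> 'cV[R]_d) (eps_f eps_g : R).
Hypothesis eps_f_ge0 : 0 <= eps_f.
Hypothesis eps_g_ge0 : 0 <= eps_g.
Hypothesis f_error : forall z, `|f z - phi z| <= eps_f.
Hypothesis g_error : forall z, enorm (g z - grad phi z) <= eps_g.
Variables (c1 c2 : R).
Hypothesis c1_gt0 : 0 < c1.
Hypothesis c1_lt_c2 : c1 < c2.
Hypothesis c2_lt1 : c2 < 1.

Lemma constA_sqr_ge :
  512 / ((c2 - c1) * (4 - c1 - 3 * c2)) <= constA c1 c2 ^+ 2.
Proof.
have C1 := c1_gt0; have C12 := c1_lt_c2; have C2 := c2_lt1.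
set D := (c2 - c1) * (4 - c1 - 3 * c2).
have D0 : 0 < D by rewrite /D mulr_gt0 //; lra.
have a0 : 0 <= 16 * Num.sqrt 2 / Num.sqrt D :> R.
  by rewrite divr_ge0 ?mulr_ge0 ?sqrtr_ge0.
have -> : 512 / D = (16 * Num.sqrt 2 / Num.sqrt D) ^+ 2.
  by rewrite expr_div_n exprMn !sqr_sqrtr ?ltW //; congr (_ / _); ring.
have aA : 16 * Num.sqrt 2 / Num.sqrt D <= constA c1 c2.
  by rewrite /constA le_max lexx.
by rewrite ler_sqr // nnegrE (le_trans a0).
Qed.

(** Multiplying the threshold by [b] isolates the noise: [constB] controls [eps_g] linearly, the
    square of [constA] controls [M * eps_f]. *)
Lemma N1_complement b x : 0 < b -> b <= 1 ->
  ~ N1 phi M eps_f eps_g c1 c2 b x ->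
  [/\ 8 * eps_g <= (1 - c2) * (b * enorm (grad phi x)),
      8 * eps_g <= (c2 - c1) * (b * enorm (grad phi x)) &
      512 * (M * eps_f) <=
        (c2 - c1) * (4 - c1 - 3 * c2) * (b * enorm (grad phi x)) ^+ 2].
Proof.
have C1 := c1_gt0; have C12 := c1_lt_c2; have C2 := c2_lt1.
move=> b0 b1 /negP; rewrite -ltNge gt_max => /andP[hA hB].
set G := enorm (grad phi x) in hA hB *.
have bV : b * b^-1 = 1 by rewrite divff // gt_eqF.
have {}hA : constA c1 c2 * Num.sqrt (M * eps_f) < b * G.
  rewrite -(ltr_pM2l b0) in hA; apply: le_lt_trans hA.
  by rewrite mulrCA [b * (_ / b)]mulrCA bV mulr1.
have {}hB : constB c1 c2 * eps_g < b * G.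
  rewrite -(ltr_pM2l b0) in hB; apply: le_lt_trans hB.
  by rewrite mulrCA [b * (_ / b)]mulrCA bV mulr1.
have B1 : 8 / (1 - c2) <= constB c1 c2 by rewrite /constB le_max lexx.
have B2 : 8 / (c2 - c1) <= constB c1 c2.
  rewrite /constB le_max; apply/orP; right.
  have : 8 / (c2 - c1) <= 8 * (1 + c1) / (c2 - c1).
    by rewrite ler_pM2r ?invr_gt0; lra.
  lra.
have bnd (c : R) : 0 < c -> 8 / c <= constB c1 c2 -> 8 * eps_g <= c * (b * G).
  move=> c0 cB.
  have -> : 8 * eps_g = c * (8 / c * eps_g) by field; rewrite gt_eqF.
  by rewrite ler_pM2l // (le_trans _ (ltW hB)) // ler_wpM2r.
split; [by apply: bnd; lra | by apply: bnd; lra |].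
have Me : 0 <= M * eps_f by rewrite mulr_ge0 // ltW.
have A0 : 0 <= constA c1 c2.
  by rewrite /constA le_max divr_ge0 ?mulr_ge0 ?sqrtr_ge0.
have lhs0 : 0 <= constA c1 c2 * Num.sqrt (M * eps_f).
  by rewrite mulr_ge0 ?sqrtr_ge0.
have bG0 : 0 <= b * G by rewrite mulr_ge0 ?enorm_ge0 // ltW.
have : (constA c1 c2 * Num.sqrt (M * eps_f)) ^+ 2 <= (b * G) ^+ 2.
  by rewrite ler_sqr ?nnegrE // ltW.
rewrite exprMn sqr_sqrtr // => sq.
have D0 : 0 < (c2 - c1) * (4 - c1 - 3 * c2) by rewrite mulr_gt0 //; lra.
have := constA_sqr_ge; rewrite ler_pdivrMr // => A2.
set D := (c2 - c1) * _ in D0 A2 *.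
have h1 : 512 * (M * eps_f) <= constA c1 c2 ^+ 2 * D * (M * eps_f).
  by rewrite ler_wpM2r.
rewrite (le_trans h1) // mulrAC mulrC ler_wpM2l //; exact: ltW.
Qed.

(** * One iteration at a good point outside [N1] *)

Section Step.
Variables (x p : 'cV[R]_d) (b : R).
Hypothesis b_gt0 : 0 < b.
Hypothesis b_le1 : b <= 1.
Hypothesis p_neq0 : p != 0.
Hypothesis xN1 : ~ N1 phi M eps_f eps_g c1 c2 b x.
Hypothesis cos_ge : b * (enorm p * enorm (g x)) <= - dot p (g x).

Let a := - dot p (g x).
Let G := enorm (grad phi x).

(** The gradient error is at most [G / 8], so [|g x| >= 7/8 G]; the cosine bound carries this over
    to the slope. *)
Lemma descent_slope_ge : 7 / 8 * (b * G) * enorm p <= a.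
Proof.
have C1 := c1_gt0; have C12 := c1_lt_c2; have C2 := c2_lt1.
have [e1 _ _] := N1_complement b_gt0 b_le1 xN1; rewrite -/G in e1.
have G0 : 0 <= G := enorm_ge0 _.
have P0 : 0 < enorm p by rewrite enorm_gt0.
have bG : b * G <= G by rewrite ler_piMl.
have eG : 8 * eps_g <= G.
  rewrite (le_trans e1) // (le_trans _ bG) //.
  by rewrite ler_piMl ?mulr_ge0 ?(ltW b_gt0) //; lra.
have gG : G - eps_g <= enorm (g x).
  have := enormD (g x) (grad phi x - g x).
  by rewrite addrC subrK enormC => h; have := g_error x; rewrite /G; lra.
apply: le_trans cos_ge.
have -> : 7 / 8 * (b * G) * enorm p = b * (enorm p * (7 / 8 * G)) by ring.
by rewrite ler_pM2l // ler_pM2l //; lra.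
Qed.

(** Measures slope errors as a fraction of [a]: with [c = c2 - c1] for the existence of a step, with
    [c = 1 - c2] for its decrease. *)
Lemma noise_le_slope (c : R) : 0 <= c -> 8 * eps_g <= c * (b * G) ->
  eps_g * enorm p <= c / 7 * a.
Proof.
have C1 := c1_gt0; have C12 := c1_lt_c2; have C2 := c2_lt1.
move=> c0 h; have P0 := enorm_ge0 p.
have h1 : c / 7 * (7 / 8 * (b * G) * enorm p) <= c / 7 * a.
  by rewrite ler_wpM2l ?divr_ge0 //; exact: descent_slope_ge.
apply: le_trans h1.
have -> : c / 7 * (7 / 8 * (b * G) * enorm p) = c * (b * G) / 8 * enorm p.
  by field.
by rewrite ler_wpM2r //; lra.
Qed.

(** If [G = 0] the point would lie in [N1], whose threshold is nonnegative. *)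
Lemma slope_gt0 : 0 < a.
Proof.
have P0 : 0 < enorm p by rewrite enorm_gt0.
have [G0|G0] := ltrP 0 G.
  by apply: lt_le_trans descent_slope_ge; rewrite !mulr_gt0.
case: xN1; rewrite /N1 /=.
have -> : enorm (grad phi x) = 0 by apply/eqP; rewrite eq_le G0 enorm_ge0.
rewrite le_max mulr_ge0 ?divr_ge0 ?sqrtr_ge0 ?(ltW b_gt0) //.
by rewrite /constA le_max divr_ge0 ?mulr_ge0 ?sqrtr_ge0.
Qed.

Lemma grad_slope_diff z :
  `|dot p (g z) - dot (grad phi z) p| <= eps_g * enorm p.
Proof.
have C1 := c1_gt0; have C12 := c1_lt_c2; have C2 := c2_lt1.
have P0 := enorm_ge0 p.
have -> : dot p (g z) - dot (grad phi z) p = dot p (g z - grad phi z).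
  by rewrite dotDr dotNr (dotC p (grad phi z)).
have h := ler_wpM2l P0 (g_error z).
have := dot_le p (g z - grad phi z); have := dot_geN p (g z - grad phi z).
by rewrite ler_norml => *; apply/andP; split; lra.
Qed.

Lemma line_search_exists :
  exists t, 0 < t /\ armijo_wolfe f g c1 c2 x p t.
Proof.
have C1 := c1_gt0; have C12 := c1_lt_c2; have C2 := c2_lt1.
have [_ e2 e3] := N1_complement b_gt0 b_le1 xN1; rewrite -/G in e2 e3.
have a0 := slope_gt0.
have := noise_le_slope _ e2; rewrite subr_ge0 => /(_ (ltW c1_lt_c2)) noise.
have := grad_slope_diff x; rewrite ler_norml => /andP[nx1 nx2].
(* [4 (1 - c') = 4 - c1 - 3 c2] and [c' - c1 = 3/4 (c2 - c1)], the two factors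
   in the first term of [constA]. *)
pose c' := (c1 + 3 * c2) / 4.
have c'0 : 0 < c' by rewrite /c'; lra.
have [||t t0 slope] := @slope_attained x p (c' * a) p_neq0.
- by rewrite /c' /a in noise nx1 nx2 a0 *; nra.
- by rewrite mulr_ge0 // ltW.
(* The Wolfe half: [c2 - c' = (c2 - c1) / 4] exceeds the noise share [(c2 - c1) / 7]. *)
exists t; split=> //; split; last first.
  have := grad_slope_diff (x + t *: p).
  rewrite slope ler_norml => /andP[h _].
  by move: h; rewrite -[dot p (g x)]opprK -/a /c'; nra.
have pp : 0 < dot p p by rewrite dot_gt0.
(* Strong convexity is used from the new point, where the slope is known, back to [x]. *)
have convex : phi (x + t *: p) + t * (c' * a) <= phi x.
  have := strongly_convex_grad phi_diff M_gt0 phi_lip m_gt0 phi_convex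
    (x + t *: p) (- (t *: p)).
  have -> : dot (grad phi (x + t *: p)) (- (t *: p)) = t * (c' * a).
    by rewrite dotNr dotZr slope; ring.
  rewrite addrK; apply: le_trans.
  by rewrite lerDl mulr_ge0 ?dot_ge0 // divr_ge0 // ltW.
(* The slope of [phi] rises from at most [- (1 - (c2 - c1) / 7) a] to [- c' a]. Since
   [c2 - c1 <= 4 (1 - c')], noise costs at most 4/7 of [(1 - c') a]. *)
have long : 3 / 7 * (1 - c') * a <= M * t * dot p p.
  have := grad_line_le phi_lip x p (ltW t0).
  rewrite dotDl dotNl slope ler_norml => /andP[_]; apply: le_trans.
  by rewrite /c' /a in noise nx1 nx2 a0 *; nra.
have slope_ge := descent_slope_ge.
have P0 : 0 < enorm p by rewrite enorm_gt0.
have bG0 : 0 <= b * G by rewrite mulr_ge0 ?(ltW b_gt0) ?enorm_ge0.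
set D := (c2 - c1) * (4 - c1 - 3 * c2) in e3.
have D0 : 0 < D by rewrite mulr_gt0 //; lra.
have asq : 49 / 64 * (b * G) ^+ 2 * dot p p <= a ^+ 2.
  have -> : 49 / 64 * (b * G) ^+ 2 * dot p p = (7 / 8 * (b * G) * enorm p) ^+ 2.
    by rewrite -enorm_sqr; field.
  have lhs0 : 0 <= 7 / 8 * (b * G) * enorm p.
    by rewrite mulr_ge0 ?enorm_ge0 // mulr_ge0.
  by rewrite ler_sqr // nnegrE ltW.
(* The surplus over the Armijo decrease must absorb the errors in two values of [f]. The constants
   give [9/112 * 49/64 * 512 = 63/2], well above the required 2. *)
have gain : 2 * eps_f <= t * ((c' - c1) * a).
  have Mpp : 0 < M * dot p p by rewrite mulr_gt0.
  rewrite -(ler_pM2r Mpp).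
  have ca : 0 <= (c' - c1) * a by rewrite mulr_ge0 ?(ltW a0) // /c'; lra.
  have -> : t * ((c' - c1) * a) * (M * dot p p) =
    (M * t * dot p p) * ((c' - c1) * a) by ring.
  apply: le_trans (ler_wpM2r ca long).
  have -> : 3 / 7 * (1 - c') * a * ((c' - c1) * a) = 9 / 112 * D * a ^+ 2.
    by rewrite /c' /D; field.
  have h1 : 9 / 112 * D * (49 / 64 * (b * G) ^+ 2 * dot p p) <=
      9 / 112 * D * a ^+ 2.
    by rewrite ler_pM2l // mulr_gt0.
  apply: le_trans h1.
  have h2 := ler_wpM2r (ltW pp) e3.
  have h3 : 0 <= M * eps_f * dot p p.
    by rewrite mulr_ge0 ?(ltW pp) // mulr_ge0 // ltW.
  lra.
have := f_error x; have := f_error (x + t *: p); rewrite !ler_norml.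
move=> /andP[_ fz] /andP[fx _].
rewrite -[dot p (g x)]opprK -/a mulrN.
by move: gain; rewrite mulrBl mulrBr; lra.
Qed.

(** The Wolfe condition forces the noisy slope up by [(1 - c2) a], of which two gradient errors cost
    at most 2/7. The Lipschitz bound then makes [t] long, and Armijo turns length into decrease;
    [5/7 * 49/64 > 1/2] explains the constant. *)
Lemma armijo_wolfe_decrease t : 0 < t -> armijo_wolfe f g c1 c2 x p t ->
  f (x + t *: p) <= f x - c1 * (1 - c2) * b ^+ 2 / (2 * M) * G ^+ 2.
Proof.
have C1 := c1_gt0; have C12 := c1_lt_c2; have C2 := c2_lt1.
move=> t0 [armijo wolfe].
have [e1 _ _] := N1_complement b_gt0 b_le1 xN1; rewrite -/G in e1.
have a0 := slope_gt0.
have := noise_le_slope _ e1; rewrite subr_ge0 => /(_ (ltW c2_lt1)) noise.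
have := grad_slope_diff x; rewrite ler_norml => /andP[nx1 nx2].
have := grad_slope_diff (x + t *: p); rewrite ler_norml => /andP[nz1 nz2].
have pp : 0 < dot p p by rewrite dot_gt0.
have long : 5 / 7 * (1 - c2) * a <= M * t * dot p p.
  have := grad_line_le phi_lip x p (ltW t0).
  rewrite dotDl dotNl ler_norml => /andP[_]; apply: le_trans.
  by rewrite /a in noise a0 *; nra.
have slope_ge := descent_slope_ge.
have P0 : 0 < enorm p by rewrite enorm_gt0.
have bG0 : 0 <= b * G by rewrite mulr_ge0 ?(ltW b_gt0) ?enorm_ge0.
have asq : 49 / 64 * (b * G) ^+ 2 * dot p p <= a ^+ 2.
  have -> : 49 / 64 * (b * G) ^+ 2 * dot p p = (7 / 8 * (b * G) * enorm p) ^+ 2.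
    by rewrite -enorm_sqr; field.
  have lhs0 : 0 <= 7 / 8 * (b * G) * enorm p.
    by rewrite mulr_ge0 ?enorm_ge0 // mulr_ge0.
  by rewrite ler_sqr // nnegrE ltW.
have gain : (1 - c2) * (b * G) ^+ 2 / (2 * M) <= t * a.
  have Mpp : 0 < M * dot p p by rewrite mulr_gt0.
  rewrite -(ler_pM2r Mpp).
  have -> : t * a * (M * dot p p) = (M * t * dot p p) * a by ring.
  apply: le_trans (ler_wpM2r (ltW a0) long).
  have -> : (1 - c2) * (b * G) ^+ 2 / (2 * M) * (M * dot p p) =
      (1 - c2) * (1 / 2 * (b * G) ^+ 2 * dot p p).
    by field; rewrite gt_eqF.
  have -> : 5 / 7 * (1 - c2) * a * a = (1 - c2) * (5 / 7 * a ^+ 2) by ring.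
  rewrite ler_pM2l ?subr_gt0 //.
  have : 0 <= (b * G) ^+ 2 * dot p p by rewrite mulr_ge0 ?sqr_ge0 // ltW.
  lra.
have := ler_wpM2l (ltW c1_gt0) gain.
have -> : c1 * ((1 - c2) * (b * G) ^+ 2 / (2 * M)) =
    c1 * (1 - c2) * b ^+ 2 / (2 * M) * G ^+ 2.
  by rewrite exprMn; field; rewrite gt_eqF.
by move: armijo; rewrite -[dot p (g x)]opprK -/a mulrN; lra.
Qed.

End Step.

End LineSearch.

(** * Counting good indices, decay along them, and the first entry time *)

Section Counting.
Context {R : realType}.
Implicit Types (good : nat -> bool) (e psi : nat -> R).

(** Summing the steps bounds [b0] times the number of bad indices by [psi 0 + k c], hence by
    [k (psi 0 + c) = k (1 - q) b0] when [k >= 1]. *)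
Lemma linear_count psi good (c b0 q : R) :
  0 < b0 -> (forall k, 0 <= psi k) -> psi 0%N + c = (1 - q) * b0 ->
  (forall k, psi k.+1 <= psi k + c - (~~ good k)%:R * b0) ->
  forall k, q * k%:R <= (\sum_(j < k) good j)%N%:R.
Proof.
move=> b0_gt0 psi0 defc step k.
have sum_le : psi k + b0 * (k%:R - (\sum_(j < k) good j)%N%:R)
    <= psi 0%N + k%:R * c.
  elim: k => [|k IHk]; first by rewrite big_ord0 subrr mulr0 mul0r.
  rewrite big_ord_recr /= natrD -[in k.+1%:R]addn1 natrD.
  move: (step k) IHk; case: (good k) => /=; lra.
case: k sum_le => [|k] sum_le; first by rewrite mulr0.
have k1 : 0 <= k%:R * psi 0%N by rewrite mulr_ge0.
rewrite -(ler_pM2l b0_gt0); have := psi0 k.+1; move: sum_le.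
move: (\sum_(_ < _) _)%N => G.
have -> : c = (1 - q) * b0 - psi 0%N by rewrite -defc addrC addKr.
rewrite -[in k.+1%:R]addn1 natrD; lra.
Qed.

(** The sign of [e] is left free: the optimality gap of [f] shifted by [eps_f] may be negative. *)
Lemma geometric_decay e good (r C : R) N : 0 <= r -> 0 <= C -> e 0%N <= C ->
  (forall j, (j < N)%N -> e j.+1 <= e j) ->
  (forall j, (j < N)%N -> good j -> e j.+1 <= r * e j) ->
  e N <= r ^+ (\sum_(j < N) good j) * C.
Proof.
move=> r0 C0 e0; elim: N => [|N IHN] mono decay.
  by rewrite big_ord0 expr0 mul1r.
have {}IHN : e N <= r ^+ (\sum_(j < N) good j) * C.
  by apply: IHN => j jN; [apply: mono | apply: decay]; rewrite ltnS ltnW.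
rewrite big_ord_recr /=; have [gN|gN] := boolP (good N).
  rewrite (le_trans (decay N _ gN)) // addn1 exprS -mulrA.
  exact: ler_wpM2l.
by rewrite addn0 (le_trans _ IHN) // mono.
Qed.

(** An entry at [j < k] would give [k <= j - 1]. With no entry at all, the premise reads [k <= +oo]
    and holds for every [k]. *)
Lemma before_first_entry (T : Type) (x : nat -> T) (N : set T) k :
  ((k%:R : R)%:E <= first_entry R x N - 1)%E ->
  forall j, (j < k)%N -> ~ N (x j).
Proof.
move=> kK j jk Nj.
have Kj : (first_entry R x N <= (j%:R : R)%:E)%E.
  by apply: ereal_inf_lbound; exists j.
have : ((k%:R : R)%:E <= (j%:R : R)%:E - 1)%E.
  by rewrite (le_trans kK) // leeB.
rewrite -EFinB lee_fin lerBrDr natr1 ler_nat.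
by move=> kj; have := leq_trans kj (ltnW jk); rewrite ltnn.
Qed.

End Counting.

(** * The optimality gap bounded by the gradient *)

Section Gap.
Context {R : realType} {d : nat}.
Variables (phi : 'cV[R]_d -> R) (m M : R).
Hypothesis phi_diff : forall x, differentiable phi x.
Hypothesis M_gt0 : 0 < M.
Hypothesis phi_lip : lipschitz_gradient M phi.
Hypothesis m_gt0 : 0 < m.
Hypothesis phi_convex : strongly_convex m phi.
Hypothesis phi_lb : has_lbound (range phi).

Lemma inf_range_le x : inf (range phi) <= phi x.
Proof. by apply: ge_inf => //; exists x. Qed.

(** The strong convexity bound is minimized over the displacement [v] by completing the square
    [|G + m v|^2]; working with the infimum avoids producing a minimizer. *)
Lemma polyak_lojasiewicz x :
  2 * m * (phi x - inf (range phi)) <= enorm (grad phi x) ^+ 2.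
Proof.
have m0 := m_gt0; set G := grad phi x.
suff : phi x - enorm G ^+ 2 / (2 * m) <= inf (range phi).
  move=> h; have {}h : phi x - inf (range phi) <= enorm G ^+ 2 / (2 * m) by lra.
  by move: h; rewrite ler_pdivlMr ?mulr_gt0 // mulrC.
apply: lb_le_inf; first by exists (phi x), x.
move=> _ [z _ <-]; have -> : z = x + (z - x) by rewrite addrC subrK.
move: (z - x) => v.
have := strongly_convex_grad phi_diff M_gt0 phi_lip m_gt0 phi_convex x v.
apply: le_trans; rewrite -/G enorm_sqr.
have := dot_ge0 (G + m *: v); rewrite !dot_lin (dotC v G) => sq.
rewrite -subr_ge0.
have -> : phi x + dot G v + m / 2 * dot v v - (phi x - dot G G / (2 * m)) =
  (dot G G + m * dot G v + m * (dot G v + m * dot v v)) / (2 * m).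
  by field; rewrite gt_eqF.
by apply: divr_ge0; [move: sq; lra | rewrite mulr_ge0 // ltW].
Qed.

End Gap.

(** * Lengthened steps and the sign of step lengths *)

Section Step.
Context {R : realType} {d : nat}.
Implicit Types (p : 'cV[R]_d).

(** A failed search has [a = 0], but then the norm is [0 < l] and the lengthened branch is taken, so
    the multiple of [p] is always positive. *)
Lemma lengthened_stepP (l a : R) p : 0 < l -> 0 <= a -> p != 0 ->
  exists2 t : R, 0 < t & lengthened_step l a p = t *: p /\
    l <= enorm (lengthened_step l a p).
Proof.
move=> l0 a0 p0; have P0 : 0 < enorm p by rewrite enorm_gt0.
rewrite /lengthened_step; case: ifPn => [la|_].
  exists a => //; rewrite lt_neqAle a0 andbT eq_sym.
  apply: contraTneq la => ->; rewrite -ltNge scale0r.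
  by rewrite /enorm dot0l sqrtr0.
exists (l / enorm p); rewrite ?divr_gt0 //; split=> //.
by rewrite enormZ gtr0_norm ?divr_gt0 // divfK // gt_eqF.
Qed.

Lemma line_search_ge0 (f : 'cV[R]_d -> R) (g : 'cV[R]_d -> 'cV[R]_d)
    c1 c2 x p a :
  line_search f g c1 c2 x p a -> 0 <= a.
Proof.
move=> [h1 h2]; have [e|e] :=
    pselect (exists b, 0 < b /\ armijo_wolfe f g c1 c2 x p b).
  by rewrite ltW //; case: (h1 e).
by rewrite (h2 e).
Qed.

End Step.

(** * Invariants of a run and the number of good iterations *)

Section Run.
Context {R : realType} {d : nat}.
Variables (phi : 'cV[R]_d -> R) (m M : R).
Hypothesis phi_diff : forall x, differentiable phi x.
Hypothesis M_gt0 : 0 < M.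
Hypothesis phi_lip : lipschitz_gradient M phi.
Hypothesis m_gt0 : 0 < m.
Hypothesis m_le_M : m <= M.
Hypothesis phi_convex : strongly_convex m phi.
Variables (f : 'cV[R]_d -> R) (g : 'cV[R]_d -> 'cV[R]_d) (eps_g : R).
Hypothesis eps_g_ge0 : 0 <= eps_g.
Hypothesis g_error : forall z, enorm (g z - grad phi z) <= eps_g.
Variables (c1 c2 l : R).
Hypothesis l_gt0 : 0 < l.
Hypothesis l_large : 2 * eps_g / m < l.
Variables (x0 : 'cV[R]_d) (H0 : 'M[R]_d).
Hypothesis H0_posdef : sym_posdef H0.
Variables (x p s y : nat -> 'cV[R]_d) (alpha : nat -> R) (H : nat -> 'M[R]_d).
Hypothesis run : bfgs_with_errors f g c1 c2 l x0 H0 x p s y alpha H.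
Hypothesis g_neq0 : forall k, g (x k) != 0.

Let mh := m_hat m eps_g l.
Let Mh := M_hat M eps_g l.

Lemma m_hat_gt0 : 0 < mh.
Proof.
rewrite /mh /m_hat subr_gt0 ltr_pdivrMr //.
by move: l_large; rewrite ltr_pdivrMr // [l * m]mulrC.
Qed.

Lemma dim_gt0 : (0 < d)%N.
Proof.
rewrite lt0n; apply: contraNneq (g_neq0 0) => d0.
by apply/eqP/matrixP => i; have := ltn_ord i; rewrite {2}d0.
Qed.

Lemma descent_dir k : sym_posdef (H k) -> 0 < - dot (p k) (g (x k)).
Proof.
move=> [_ Hpos]; rewrite (bfgs_p run) dotNl opprK dotC.
exact: Hpos.
Qed.

Lemma step_parallel k : sym_posdef (H k) ->
  p k != 0 /\ exists2 t : R, 0 < t & s k = t *: p k /\ l <= enorm (s k).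
Proof.
move=> /descent_dir pg.
have p0 : p k != 0.
  by apply: contraTneq pg => ->; rewrite dot0l oppr0 ltxx.
split=> //; rewrite (bfgs_s run); apply: lengthened_stepP => //.
exact: line_search_ge0 (bfgs_alpha run k).
Qed.

(** The purpose of lengthening: the two gradient errors total at most [2 eps_g], and [|s| >= l]
    makes this at most [(2 eps_g / l) |s|]. *)
Lemma step_curvature k : sym_posdef (H k) ->
  mh * dot (s k) (s k) <= dot (s k) (y k) /\
  dot (y k) (y k) <= Mh * dot (s k) (y k).
Proof.
move=> Hk; have [_ [t t0 [_ ls]]] := step_parallel Hk.
have d0 : 0 <= 2 * eps_g / l by rewrite divr_ge0 ?mulr_ge0 // ltW.
apply: (noisy_curvature m_le_M _ d0
  (cocoercive phi_diff M_gt0 phi_lip m_gt0 phi_convex (x k) (s k) m_le_M)).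
  by move: m_hat_gt0; rewrite /mh /m_hat subr_gt0.
rewrite (bfgs_y run).
have -> : g (x k + s k) - g (x k) - (grad phi (x k + s k) - grad phi (x k)) =
    (g (x k + s k) - grad phi (x k + s k)) - (g (x k) - grad phi (x k)).
  by rewrite !opprB !addrA addrAC [RHS]addrAC; congr (_ + _); rewrite addrAC.
apply: le_trans (enormB _ _) _.
apply: (@le_trans _ _ (2 * eps_g)).
  by rewrite mulr_natl mulr2n lerD.
have -> : 2 * eps_g / l * enorm (s k) = 2 * eps_g * (enorm (s k) / l) by ring.
by rewrite ler_peMr ?mulr_ge0 // ler_pdivlMr // mul1r.
Qed.

Lemma H_posdef k : sym_posdef (H k).
Proof.
elim: k => [|k IHk]; first by rewrite (bfgs_H0 run).
rewrite (bfgs_H run); apply: posdef_bfgs_update => //.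
have [p0 [t t0 [sE _]]] := step_parallel IHk.
have [lo _] := step_curvature IHk.
rewrite (lt_le_trans _ lo) // mulr_gt0 ?m_hat_gt0 // dot_gt0 sE.
by rewrite scaler_eq0 negb_or p0 gt_eqF.
Qed.

Let gap k := lndet_gap (invmx (H k)).

Lemma gap_step k : gap k.+1 <= gap k + (Mh - 1 - ln mh) +
  ln (dot (p k) (g (x k)) ^+ 2 /
      (dot (p k) (p k) * dot (g (x k)) (g (x k)))).
Proof.
have Hk := H_posdef k.
have [p0 [t t0 [sE _]]] := step_parallel Hk.
have [lo up] := step_curvature Hk.
have s0 : s k != 0 by rewrite sE scaler_eq0 negb_or p0 gt_eqF.
have := lndet_gap_update Hk s0 m_hat_gt0 lo up.
rewrite /= -(bfgs_H run) -/(gap k.+1) -/(gap k).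
(* As [p = - H g], the vector [B s] is a negative multiple of [g], so the cosine can be read between
   [p] and [g]. *)
have -> : invmx (H k) *m s k = - (t *: g (x k)).
  rewrite sE (bfgs_p run) -scalemxAr mulmxN mulKmx ?scalerN //.
  exact: posdef_unit.
have -> : dot (s k) (- (t *: g (x k))) ^+ 2 / (dot (s k) (s k) *
      dot (- (t *: g (x k))) (- (t *: g (x k)))) =
    dot (p k) (g (x k)) ^+ 2 / (dot (p k) (p k) * dot (g (x k)) (g (x k))).
  rewrite sE !(dotNl, dotNr, dotZl, dotZr); field.
  by rewrite (gt_eqF t0) !dot_eq0 p0 g_neq0.
by rewrite !addrA.
Qed.

Variable q : R.
Hypothesis q_lt1 : q < 1.
Let b0 := beta0 H0 m M eps_g l q.
Let b1 := beta1 H0 m M eps_g l q.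

Lemma gap_cst_ge0 : 0 <= Mh - 1 - ln mh.
Proof.
have := @le_ln1Dx _ (mh - 1); rewrite [1 + _]addrC subrK ltrBrDr addNr.
move=> /(_ m_hat_gt0).
have : 0 <= 2 * eps_g / l by rewrite divr_ge0 ?mulr_ge0 // ltW.
by have := m_le_M; rewrite /Mh /mh /M_hat /m_hat; lra.
Qed.

Lemma gap_ge1 k : 1 <= gap k.
Proof.
apply: le_trans (lndet_gap_ge (posdef_inv (H_posdef k))).
by rewrite ler1n dim_gt0.
Qed.

(** The definition of [beta0] rearranged into the balance that [linear_count] requires. *)
Lemma beta0E : gap 0%N + (Mh - 1 - ln mh) = (1 - q) * b0.
Proof.
rewrite /b0 /beta0 /gap /lndet_gap (bfgs_H0 run) -/mh -/Mh.
by field; rewrite subr_eq0 gt_eqF.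
Qed.

Lemma beta0_gt0 : 0 < b0.
Proof.
have q1 : 0 < 1 - q by rewrite subr_gt0.
rewrite -(pmulr_rgt0 _ q1) -beta0E.
by have := gap_ge1 0; have := gap_cst_ge0; lra.
Qed.

Let good k := b1 * (enorm (p k) * enorm (g (x k))) <= - dot (p k) (g (x k)).

Lemma good_count k : q * k%:R <= (\sum_(j < k) good j)%N%:R.
Proof.
apply: (linear_count beta0_gt0 _ beta0E) => [j|j].
  by rewrite (le_trans _ (gap_ge1 j)).
apply: le_trans (gap_step j) _; rewrite lerD2l.
have [p0 _] := step_parallel (H_posdef j).
have pg := descent_dir (H_posdef j).
set P := enorm (p j); set G := enorm (g (x j)).
have P0 : 0 < P by rewrite enorm_gt0.
have G0 : 0 < G by rewrite enorm_gt0.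
have PG0 : 0 < P * G by rewrite mulr_gt0.
have pg2 : dot (p j) (g (x j)) ^+ 2 = (- dot (p j) (g (x j))) ^+ 2.
  by rewrite sqrrN.
rewrite -!enorm_sqr -/P -/G -exprMn pg2 -expr_div_n.
have r0 : 0 < - dot (p j) (g (x j)) / (P * G) by rewrite divr_gt0.
have [gj|] := boolP (good j).
  rewrite mul0r oppr0 ln_le0 // expr_le1 ?(ltW r0) // ler_pdivrMr // mul1r.
  by rewrite -dotNl (le_trans (dot_le _ _)) // enormN.
rewrite mul1r -ltNge -/P -/G -ltr_pdivrMr // => bad.
have b1_gt0 : 0 < b1 by exact: expR_gt0.
(* A bad index has squared cosine below [b1 ^+ 2 = expR (- b0)], which costs the potential [b0]. *)
have -> : - b0 = ln (b1 ^+ 2).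
  by rewrite lnXn // /b1 /beta1 expRK -/b0 mulr2n; field.
by rewrite ler_ln ?posrE ?exprn_gt0 // ler_sqr ?nnegrE; exact: ltW.
Qed.

End Run.

Theorem theorem3p16 (R : realType) (d : nat)
  (phi : 'cV[R]_d -> R) (m M : R)
  (phi_bounded_below : has_lbound (range phi))
  (phi_C2 : twice_continuously_differentiable phi)
  (M_gt0 : 0 < M) (phi_lipschitz : lipschitz_gradient M phi)
  (m_gt0 : 0 < m) (m_le_M : m <= M) (phi_convex : strongly_convex m phi)
  (f : 'cV[R]_d -> R) (g : 'cV[R]_d -> 'cV[R]_d) (eps_f eps_g : R)
  (eps_f_ge0 : 0 <= eps_f) (eps_g_ge0 : 0 <= eps_g)
  (f_error : forall z, `|f z - phi z| <= eps_f)
  (g_error : forall z, enorm (g z - grad phi z) <= eps_g)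
  (c1 c2 l : R) (c1_gt0 : 0 < c1) (c1_lt_c2 : c1 < c2) (c2_lt1 : c2 < 1)
  (l_gt0 : 0 < l) (l_large : 2 * eps_g / m < l)
  (x0 : 'cV[R]_d) (H0 : 'M[R]_d) (H0_posdef : sym_posdef H0)
  (x p s y : nat -> 'cV[R]_d) (alpha : nat -> R) (H : nat -> 'M[R]_d)
  (x_bfgs : bfgs_with_errors f g c1 c2 l x0 H0 x p s y alpha H)
  (g_neq0 : forall k, g (x k) != 0)
  (q : R) (q_gt0 : 0 < q) (q_lt1 : q < 1) :
  let b1 := beta1 H0 m M eps_g l q in
  let K := first_entry R x (N1 phi M eps_f eps_g c1 c2 b1) in
  let phi_star := inf (range phi) in
  exists rho : R, 0 < rho < 1 /\
    forall k : nat, ((k%:R : R)%:E <= K - 1)%E ->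
      phi (x k) - phi_star <= rho ^+ k * (phi x0 - phi_star) + 2 * eps_f.
Proof.
move=> b1 K phi_star; have [phi_diff _ _] := phi_C2.
have b1_gt0 : 0 < b1 := expR_gt0 _.
have b1_le1 : b1 <= 1.
  rewrite -expR0 ler_expR mulNr oppr_le0 divr_ge0 // ltW //.
  exact: (beta0_gt0 phi_diff M_gt0 phi_lipschitz m_gt0 m_le_M phi_convex
    eps_g_ge0 g_error l_gt0 l_large H0_posdef x_bfgs g_neq0 q_lt1).
pose good j := b1 * (enorm (p j) * enorm (g (x j))) <= - dot (p j) (g (x j)).
have Hpos j : sym_posdef (H j).
  exact: (H_posdef phi_diff M_gt0 phi_lipschitz m_gt0 m_le_M phi_convex
    eps_g_ge0 g_error l_gt0 l_large H0_posdef x_bfgs g_neq0).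
have count j : q * j%:R <= (\sum_(i < j) good i)%N%:R.
  exact: (good_count phi_diff M_gt0 phi_lipschitz m_gt0 m_le_M phi_convex
    eps_g_ge0 g_error l_gt0 l_large H0_posdef x_bfgs g_neq0 q_lt1).
(* The decrease factor [c1 (1 - c2) b1^2 / (2 M)] times the constant [2 m] of
   [polyak_lojasiewicz]. *)
pose kappa := c1 * (1 - c2) * b1 ^+ 2 * (m / M).
have kappa_gt0 : 0 < kappa.
  by rewrite !mulr_gt0 ?subr_gt0 ?exprn_gt0 ?invr_gt0.
have kappa_lt1 : kappa < 1.
  have c1_lt1 : c1 < 1 := lt_trans c1_lt_c2 c2_lt1.
  have h1 : c1 * (1 - c2) < 1.
    have : c1 * (1 - c2) < c1 by rewrite gtr_pMr // ltrBlDr ltrDl; lra.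
    by move=> /lt_trans; apply.
  have h0 : 0 < c1 * (1 - c2) by rewrite mulr_gt0 ?subr_gt0.
  rewrite /kappa -mulrA; apply: le_lt_trans h1.
  rewrite ler_piMr ?(ltW h0) // mulr_ile1 ?sqr_ge0 ?(ltW (divr_gt0 _ _)) //.
    by rewrite expr_le1 // ltW.
  by rewrite ler_pdivrMr // mul1r.
have r_gt0 : 0 < 1 - kappa by rewrite subr_gt0.
have rho_gt0 : 0 < (1 - kappa) `^ q by rewrite powR_gt0.
(* At least [q k] contractions by [1 - kappa] among [k] steps amount to this factor per step. *)
exists ((1 - kappa) `^ q); split=> [|k /before_first_entry kK].
  rewrite rho_gt0 /=; have := @gt0_ltr_powR R q q_gt0 (1 - kappa) 1.
  rewrite powR1; apply.
  - by rewrite nnegrE ltW.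
  - by rewrite nnegrE.
  - by rewrite ltrBlDr ltrDl.
(* The shift gives [e j <= phi (x j) - phi_star], so a decrease of [f] by
   [kappa (phi (x j) - phi_star)] contracts [e] with no additive error. *)
pose e j := f (x j) - phi_star - eps_f.
have f_le j : f (x j) <= phi (x j) + eps_f.
  by have := f_error (x j); rewrite ler_norml => /andP[]; lra.
have f_ge j : phi (x j) <= f (x j) + eps_f.
  by have := f_error (x j); rewrite ler_norml => /andP[]; lra.
have star_le z : phi_star <= phi z by exact: inf_range_le.
have C_ge0 : 0 <= phi x0 - phi_star by rewrite subr_ge0.
have ek : e k <= (1 - kappa) ^+ (\sum_(j < k) good j) * (phi x0 - phi_star).
  apply: geometric_decay => // [|||j jk gj].
  - exact: ltW.
  - by rewrite /e -(bfgs_x0 x_bfgs); have := f_le 0%N; lra.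
  - move=> j jk; rewrite /e !lerD2r (bfgs_x x_bfgs).
    have a0 := line_search_ge0 (bfgs_alpha x_bfgs j).
    have pg := descent_dir x_bfgs g_neq0 (Hpos j).
    have [ls ls0] := bfgs_alpha x_bfgs j.
    (* A failed search leaves the iterate in place; an accepted step decreases [f] by Armijo. *)
    have [ex|ex] := pselect (exists b, 0 < b /\
        armijo_wolfe f g c1 c2 (x j) (p j) b); last first.
      by rewrite (ls0 ex) scale0r addr0.
    have [_ [armijo _]] := ls ex; apply: le_trans armijo _.
    rewrite gerDl -oppr_ge0 -mulrN mulr_ge0 ?(ltW pg) // mulr_ge0 //.
    exact: ltW.
  have [p0 _] := step_parallel l_gt0 x_bfgs g_neq0 (Hpos j).
  have xN1 := kK j jk.
  have ex := line_search_exists phi_diff M_gt0 phi_lipschitz m_gt0 phi_convex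
    eps_f_ge0 eps_g_ge0 f_error g_error c1_gt0 c1_lt_c2 c2_lt1
    b1_gt0 b1_le1 p0 xN1 gj.
  have [a_gt0 aw] := (proj1 (bfgs_alpha x_bfgs j)) ex.
  have := armijo_wolfe_decrease M_gt0 phi_lipschitz 
    eps_f_ge0 eps_g_ge0 g_error c1_gt0 c1_lt_c2 c2_lt1
    b1_gt0 b1_le1 p0 xN1 gj a_gt0 aw.
  rewrite -(bfgs_x x_bfgs).
  have pl := polyak_lojasiewicz phi_diff M_gt0 phi_lipschitz m_gt0 phi_convex
    (x j).
  have c_ge0 : 0 <= c1 * (1 - c2) * b1 ^+ 2 / (2 * M).
    by rewrite ltW // !mulr_gt0 ?invr_gt0 ?mulr_gt0 ?subr_gt0 ?exprn_gt0.
  have := ler_wpM2l c_ge0 pl.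
  have -> : c1 * (1 - c2) * b1 ^+ 2 / (2 * M) *
      (2 * m * (phi (x j) - inf (range phi))) = kappa * (phi (x j) - phi_star).
    by rewrite /kappa /phi_star; field; rewrite gt_eqF.
  have := ler_wpM2l (ltW kappa_gt0) (f_le j); rewrite /e; lra.
have rate : (1 - kappa) ^+ (\sum_(j < k) good j) <= ((1 - kappa) `^ q) ^+ k.
  rewrite -[leRHS]powR_mulrn ?powR_ge0 // -powRrM -powR_mulrn; last exact: ltW.
  by apply: ger_powR (count k); rewrite r_gt0 /= lerBlDr lerDl ltW.
(* One [eps_f] undoes the shift in [e], the other passes from [f] back to [phi]. *)
apply: (@le_trans _ _ (e k + 2 * eps_f)).
  have -> : e k + 2 * eps_f = f (x k) + eps_f - phi_star by rewrite /e; ring.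
  by rewrite lerD2r.
by rewrite lerD2r (le_trans ek) // ler_wpM2r.
Qed.
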